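(* Let $\delta>0$ and $\mathcal K=\mathcal K_\delta:=\{\mathbf g\in\mathbb R^n: g_k\le\rho_2+\delta\ \text{for all }k\}$. For all $\mathbf g\in\mathcal K$, $\|\nabla\mathcal J_{\mathrm{trans}}(\mathbf g)\|_1\le C_{\mathrm{bound}}$, where $C_{\mathrm{bound}}=C^{\mathrm{KL}}_{\mathrm{bound}}$ for the KL source and $C_{\mathrm{bound}}=C^{\chi^2}_{\mathrm{bound}}$ for the $\chi^2$ source, with $$C^{\mathrm{KL}}_{\mathrm{bound}}:=\mu(\mathcal X)\,\|\nu\|_1^{\alpha}\exp\Big(\frac{\rho_2+\delta}{\rho_1+\varepsilon}\Big),\qquad C^{\chi^2}_{\mathrm{bound}}:=\mu(\mathcal X)\,\frac{\varepsilon}{\rho_1}\,W\Big[\frac{\rho_1}{\varepsilon}e^{\rho_1/\varepsilon}\|\nu\|_1\exp\Big(\frac{\rho_2+\delta}{\varepsilon}\Big)\Big].$$ Consequently, the Hessian $\nabla^2\mathcal J$ is bounded on $\mathcal K$, and $\mathcal J$ is $L$-smooth on $\mathcal K$ with $L=\mathcal O(1/\varepsilon)$ (as $\varepsilon\to0$, the other parameters being fixed).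
   Context: $\mathcal X,\mathcal Y$ are Polish spaces, $\mu$ is a finite nonnegative measure on $\mathcal X$, $\nu=\sum_{j=1}^n\beta_j\delta_{y_j}$ with $y_1,\dots,y_n\in\mathcal Y$, $\beta_j>0$, and $b/n\le\beta_j\le B/n$ for constants $0<b\le B$; $\|\nu\|_1=\sum_j\beta_j$. The cost $c:\mathcal X\times\mathcal Y\to[0,\infty)$ is continuous, and $\varepsilon,\rho_1,\rho_2>0$. For $x\in\mathcal X$, $\mathbf g\in\mathbb R^n$: $B_j(x,\mathbf g)=\beta_j\exp\big(\tfrac{g_j-c(x,y_j)}{\varepsilon}\big)$ and $Z(x,\mathbf g)=\sum_{j=1}^nB_j(x,\mathbf g)$. The semi-dual objective of entropic unbalanced optimal transport (with $\chi^2$ target penalty) is $$\mathcal J(\mathbf g)=\mathcal J_{\mathrm{trans}}(\mathbf g)+\sum_{j=1}^n\beta_j\Big(\frac{g_j^2}{2\rho_2}-g_j\Big),$$ where: - KL source: $\mathcal J_{\mathrm{trans}}(\mathbf g)=(\rho_1+\varepsilon)\int_{\mathcal X}Z(x,\mathbf g)^\alpha d\mu(x)$, with $\alpha=\frac{\varepsilon}{\varepsilon+\rho_1}$; - $\chi^2$ source: $\mathcal J_{\mathrm{trans}}(\mathbf g)=\frac{\varepsilon^2}{\rho_1}\int_{\mathcal X}\big(W(U(x,\mathbf g))+\tfrac12W(U(x,\mathbf g))^2\big)d\mu(x)$, with $U(x,\mathbf g)=\frac{\rho_1}{\varepsilon}e^{\rho_1/\varepsilon}Z(x,\mathbf g)$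 and $W$ the Lambert function (inverse of $z\mapsto ze^z$ on $[0,\infty)$). ''$L$-smooth on $\mathcal K$'' means that $\nabla\mathcal J$ is $L$-Lipschitz on $\mathcal K$ for the Euclidean norm. *)

(* Defs.v *)
From HB Require Import structures.
From mathcomp Require Import all_boot all_order all_algebra.
From mathcomp Require Import all_classical all_reals all_analysis.

Set Implicit Arguments.
Unset Strict Implicit.
Unset Printing Implicit Defensive.

Import Order.TTheory GRing.Theory Num.Theory.
Import numFieldNormedType.Exports.

Local Open Scope classical_set_scope.
Local Open Scope ring_scope.

Definition is_metric (R : realType) (T : Type) (d : T -> T -> R) : Prop :=
  [/\ forall x y, d x y = 0 <-> x = y,
      forall x y, d x y = d y x &
      forall x y z, d x z <= d x y + d y z].

Definition metrizes (R : realType) (T : topologicalType) (d : T -> T -> R) :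
    Prop :=
  forall x : T,
    nbhs x = filter_from [set e : R | 0 < e] (fun e => [set z | d x z < e]).

Definition complete_metric (R : realType) (T : topologicalType)
    (d : T -> T -> R) : Prop :=
  forall u : nat -> T,
    (forall e : R, 0 < e ->
       exists N : nat, forall i j, (N <= i)%N -> (N <= j)%N ->
         d (u i) (u j) < e) ->
    exists l : T, u @ \oo --> l.

Definition polish_space (R : realType) (T : topologicalType) : Prop :=
  (exists2 D : set T, countable D & dense D) /\
  exists d : T -> T -> R, [/\ is_metric d, metrizes d & complete_metric d].

Notation borelType T := (g_sigma_algebraType (@open T)).

(* The inverse of z |-> z * e^z on [0, +oo[; since that map sends [0, +oo[
   onto itself, the default value 0 is only taken at negative arguments. *)
Definition lambertW (R : realType) : R -> R :=
  'pinv_(fun=> 0) [set z : R | 0 <= z] (fun z => z * expR z).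

Definition norm1 (R : realType) (n : nat) (v : 'rV[R]_n) : R :=
  \sum_(k < n) `|v 0 k|.

(* The library norm `|v| on 'rV[R]_n is the sup norm. *)
Definition norm2 (R : realType) (n : nat) (v : 'rV[R]_n) : R :=
  Num.sqrt (\sum_(k < n) v 0 k ^+ 2).

Definition gradient (R : realType) (n : nat) (f : 'rV[R]_n -> R)
    (g : 'rV[R]_n) : 'rV[R]_n :=
  \row_(k < n) 'D_(delta_mx 0 k) f g.

Definition hessian (R : realType) (n : nat) (f : 'rV[R]_n -> R)
    (g : 'rV[R]_n) : 'M[R]_n :=
  'J (gradient f) g.

(* Fréchet differentiability is required explicitly because 'D and 'd are
   total operators, with unspecified values where the derivative fails to
   exist. *)
Definition smooth_on (R : realType) (n : nat) (L : R) (f : 'rV[R]_n -> R)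
    (K : set 'rV[R]_n) : Prop :=
  (forall g, K g -> differentiable f g) /\
  (forall g h, K g -> K h ->
     norm2 (gradient f g - gradient f h) <= L * norm2 (g - h)).

Definition twice_differentiable (R : realType) (n : nat)
    (f : 'rV[R]_n -> R) (g : 'rV[R]_n) : Prop :=
  (\forall h \near g, differentiable f h) /\ differentiable (gradient f) g.

Variant source := KL | Chi2.

Definition termB (R : realType) (X Y : Type) (n : nat) (beta : 'I_n -> R)
    (y : 'I_n -> Y) (c : X -> Y -> R) (eps : R) (x : X) (g : 'rV[R]_n)
    (j : 'I_n) : R :=
  beta j * expR ((g 0 j - c x (y j)) / eps).

Definition sumZ (R : realType) (X Y : Type) (n : nat) (beta : 'I_n -> R)
    (y : 'I_n -> Y) (c : X -> Y -> R) (eps : R) (x : X) (g : 'rV[R]_n) : R :=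
  \sum_(j < n) termB beta y c eps x g j.

Definition argU (R : realType) (X Y : Type) (n : nat) (beta : 'I_n -> R)
    (y : 'I_n -> Y) (c : X -> Y -> R) (eps rho1 : R) (x : X)
    (g : 'rV[R]_n) : R :=
  rho1 / eps * expR (rho1 / eps) * sumZ beta y c eps x g.

Definition alpha (R : realType) (eps rho1 : R) : R := eps / (eps + rho1).

Definition Jtrans (R : realType) (s : source) (X : ptopologicalType)
    (Y : Type) (mu : {finite_measure set (borelType X) -> \bar R}) (n : nat)
    (beta : 'I_n -> R) (y : 'I_n -> Y) (c : X -> Y -> R) (eps rho1 : R)
    (g : 'rV[R]_n) : R :=
  match s with
  | KL => (rho1 + eps) *
      \int[mu]_x (sumZ beta y c eps x g `^ alpha eps rho1)
  | Chi2 => eps ^+ 2 / rho1 *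
      \int[mu]_x (let w := lambertW (argU beta y c eps rho1 x g) in
                  w + w ^+ 2 / 2)
  end.

Definition Jobj (R : realType) (s : source) (X : ptopologicalType)
    (Y : Type) (mu : {finite_measure set (borelType X) -> \bar R}) (n : nat)
    (beta : 'I_n -> R) (y : 'I_n -> Y) (c : X -> Y -> R) (eps rho1 rho2 : R)
    (g : 'rV[R]_n) : R :=
  Jtrans s mu beta y c eps rho1 g +
  \sum_(j < n) beta j * (g 0 j ^+ 2 / (2 * rho2) - g 0 j).

Definition Kset (R : realType) (n : nat) (rho2 delta : R) : set 'rV[R]_n :=
  [set g | forall k : 'I_n, g 0 k <= rho2 + delta].

(* \sum_j beta j is the total mass of nu = \sum_j beta_j delta_(y_j). *)
Definition Cbound (R : realType) (s : source) (X : ptopologicalType)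
    (mu : {finite_measure set (borelType X) -> \bar R}) (n : nat)
    (beta : 'I_n -> R) (eps rho1 rho2 delta : R) : R :=
  let mass_mu := fine (mu setT) in
  let mass_nu := \sum_(j < n) beta j in
  match s with
  | KL => mass_mu * mass_nu `^ alpha eps rho1 *
      expR ((rho2 + delta) / (rho1 + eps))
  | Chi2 => mass_mu * (eps / rho1) *
      lambertW (rho1 / eps * expR (rho1 / eps) * mass_nu *
                expR ((rho2 + delta) / eps))
  end.

(* Main.v *)
Require Import Defs.
From HB Require Import structures.
From mathcomp Require Import all_boot all_order all_algebra.
From mathcomp Require Import all_classical all_reals all_analysis.
From mathcomp Require Import measurable_realfun ring lra.

Set Implicit Arguments.
Unset Strict Implicit.
Unset Printing Implicit Defensive.

Import Order.TTheory GRing.Theory Num.Theory.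
Import numFieldNormedType.Exports.

Local Open Scope classical_set_scope.
Local Open Scope ring_scope.

(** Both transport terms have the form [kappa * \int F (Z x g) dmu(x)] with a
scalar profile [F] on the positive half-line: a power of exponent [alpha] for
the KL source, [W + W ^ 2 / 2] at a multiple of its argument, with [W] the
Lambert function, for the chi-square source. Since [Z] is a positive
combination of the exponentials [B_j], whose derivatives in [g_j] are
[B_j / eps], the gradient of the transport term has entries
[kappa / eps * \int F'(Z) B_k dmu]. These are nonnegative and sum to
[kappa / eps * \int Z F'(Z) dmu].

The one inequality that drives everything is [t * |F''(t)| <= F'(t)]
([profile]). It makes [t * F'(t)] nondecreasing, so that on [Kset rho2 delta],
where the nonnegative cost gives [Z <= |nu| * exp ((rho2 + delta) / eps)], the
sum above is at most its value at this upper bound; for the two profiles that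
value is [Cbound] ([Jtrans_profile], [norm1_gradient_Jtrans_le]). It also
bounds the derivative in [g] of [F'(Z) B_k / eps] by [2 Z F'(Z) / eps ^ 2], so
that each entry of the gradient is Lipschitz for the sup norm with constant
[2 * Cbound / eps] ([smooth_below_Jtrans]). The quadratic penalty adds
[|nu| / rho2]. Comparing the norms on row vectors costs a factor [n], and
[Cbound] stays bounded as [eps] varies ([Cbound_bounded]), whence
[L = O(1 / eps)].

Derivatives pass through the integral by [differentiable_Rintegral]: a family
of functions which are differentiable at a point and uniformly Lipschitz around
it has a Frechet differentiable integral, by dominated convergence. It is
applied once to [F (Z x g)] and once to its partial derivatives, which gives
twice differentiability; the Hessian is bounded because it is the differential
of a Lipschitz map. *)

(** * Integrals of bounded functions over a finite measure *)

Section FiniteMeasure.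
Context d (T : measurableType d) (R : realType).
Variable mu : {finite_measure set T -> \bar R}.
Implicit Types (f : T -> R) (M : R).

Lemma bounded_integrable f M :
  measurable_fun setT f -> (forall x, `|f x| <= M) ->
  mu.-integrable setT (EFin \o f).
Proof.
move=> mf fM; apply: measurable_bounded_integrable => //.
- exact: fin_num_fun_lty.
- exists M; split; first exact: num_real.
  by move=> N MN x _; apply: le_trans (ltW MN).
Qed.

Lemma normr_Rintegral_le f M :
  measurable_fun setT f -> (forall x, `|f x| <= M) ->
  `|\int[mu]_x f x| <= M * fine (mu setT).
Proof.
move=> mf fM; have If := bounded_integrable mf fM.
apply: le_trans (le_normr_Rintegral _ If) _ => //.
rewrite -(@Rintegral_cst _ _ _ mu setT)//; apply: le_Rintegral => //.
- apply: (@bounded_integrable _ M) => [|x]; last by rewrite normr_id.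
  exact: measurableT_comp.
- exact: (@bounded_integrable _ `|M|).
Qed.

Lemma bounded_Rintegral_cvg0 (u : nat -> T -> R) M :
  (forall m, measurable_fun setT (u m)) -> (forall m x, `|u m x| <= M) ->
  (forall x, u ^~ x @ \oo --> (0 : R)) ->
  (fun m => \int[mu]_x u m x) @ \oo --> (0 : R).
Proof.
move=> mu_ uM u0.
have -> : (0 : R) = fine (\int[mu]_x (0%:E : \bar R))%E.
  by rewrite integral0.
apply: fine_cvg; rewrite fineK; last by rewrite integral0.
apply: (@dominated_cvg _ _ _ mu setT _ (fun m x => (u m x)%:E) (cst 0%:E)
          (cst M%:E)) => //.
- by move=> m; apply/measurable_EFinP; exact: mu_.
- by move=> x _; apply: cvg_EFin; [exact: nearW|exact: u0].
- by apply: (@bounded_integrable (cst M) `|M|).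
- by move=> m x _; rewrite lee_fin.
Qed.

End FiniteMeasure.

(** * Lipschitz maps and their differentials *)

Section LipschitzDifferential.
Context (R : realType) (V : normedModType R).

Lemma normr_diff_le (W : normedModType R) (f : V -> W) (a : V) (C : R) :
  differentiable f a ->
  (\forall v \near a, `|f v - f a| <= C * `|v - a|) ->
  forall h, `|'d f a h| <= C * `|h|.
Proof.
move=> df fC h; rewrite -deriveE//.
have /cvg_norm dh : h0^-1 *: ((f \o shift a) (h0 *: h) - f a)
    @[h0 --> 0^'] --> 'D_h f a by exact: (diff_derivable df).
rewrite -(cvg_lim (@Rhausdorff R) dh).
apply: limr_le; first by apply/cvg_ex; eexists; exact: dh.
have near0 : \forall t \near 0^',
    `|f (t *: h + a) - f a| <= C * `|t *: h + a - a|.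
  have /(_ _ fC) : (t *: h + a) @[t --> (0 : R)^'] --> a.
    rewrite -[X in _ --> X]add0r -[X in X + a](scale0r h).
    apply: cvgD; last exact: cvg_cst.
    apply: cvg_trans (@scalel_continuous _ _ h 0).
    by apply: cvg_app; exact: cvg_within.
  exact.
near=> t.
have t0 : t != 0 by near: t; exact: nbhs_dnbhs_neq.
rewrite normrZ normfV ler_pdivrMl ?normr_gt0// mulrCA -normrZ.
by rewrite -[X in C * `|X|](addrK a); near: t.
Unshelve. all: by end_near. Qed.

Lemma normr_subl_le_diff (f : V -> R) (a b : V) (C : R) :
  (forall t : R, 0 <= t <= 1 -> differentiable f (a + t *: (b - a))) ->
  (forall t : R, 0 <= t <= 1 ->
     forall h, `|'d f (a + t *: (b - a)) h| <= C * `|h|) ->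
  `|f b - f a| <= C * `|b - a|.
Proof.
move=> df dfC; pose p (t : R) := f (a + t *: (b - a)).
have dp (t : R) : 0 <= t <= 1 ->
    is_derive t 1 p ('d f (a + t *: (b - a)) (b - a)).
  move=> t01.
  have dline :
      is_diff t (fun s : R => a + s *: (b - a)) (fun s => s *: (b - a)).
    have := @is_diffD R R V (cst a) (fun s : R => s *: (b - a)) 0
      (fun s : R => s *: (b - a)) t (is_diff_cst a t)
      (is_diff_scalel t (b - a)).
    by rewrite add0r.
  have D : is_diff t p ('d f (a + t *: (b - a)) \o (fun s => s *: (b - a))).
    exact: (is_diff_comp dline (differentiableP (df _ t01))).
  have [dpt dpE] := D.
  apply: DeriveDef; first exact/derivable1_diffP.
  by rewrite deriveE// dpE /= scale1r.
have [//|t||t t01 pE] := @MVT_segment R p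
    (fun t => 'd f (a + t *: (b - a)) (b - a)) 0 1.
- by rewrite in_itv/= => /andP[/ltW ? /ltW ?]; apply: dp; apply/andP.
- apply: derivable_within_continuous => t; rewrite in_itv/= => t01.
  exact: (@ex_derive _ _ _ _ _ _ _ (dp t t01)).
- move: pE; rewrite /p scale1r scale0r addr0 subr0 mulr1 (addrC a) subrK => ->.
  by apply: dfC; move: t01; rewrite in_itv.
Qed.

End LipschitzDifferential.

(** * Differentiation under the integral sign *)

Section DifferentiationUnderIntegral.
Context d (T : measurableType d) (R : realType) (V : normedModType R).
Variable mu : {finite_measure set T -> \bar R}.

(** The differential is the pointwise limit of the measurable difference
quotients with steps [1 / (m + 1)]. *)
Let measurable_diff (f : T -> V -> R) (a h : V) :
  (forall v, measurable_fun setT (f^~ v)) ->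
  (forall x, differentiable (f x) a) ->
  measurable_fun setT (fun x => 'd (f x) a h).
Proof.
move=> mf df.
pose q (m : nat) x := m.+1%:R * (f x (m.+1%:R^-1 *: h + a) - f x a).
apply: (@measurable_fun_cvg _ _ _ _ q) => [m|x _].
  by apply: measurable_funM => //; exact: measurable_funB.
have dnbhs0 : (m.+1%:R^-1 : R) @[m --> \oo] --> (0 : R)^'.
  move=> A /(@cvg_harmonic R); apply: (@filterS _ _ eventually_filter) => m.
  by apply; apply: lt0r_neq0; exact: harmonic_gt0.
have := @diff_derivable _ _ _ _ _ h (df x); rewrite -deriveE//.
move=> /(cvg_comp _ _ dnbhs0); apply: cvg_trans.
by apply: near_eq_cvg; apply: nearW => m; rewrite /q /= invrK.
Qed.

(** The remainder [q x h] of the first-order expansion at [a] is at most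
[2 * C * |h|] uniformly in [x], and is [o(h)] for each [x]. Were its integral
not [o(h)], there would be a sequence of increments along which the integral
of [q x h / |h|] stays away from 0, contradicting dominated convergence. *)
Lemma differentiable_Rintegral (f : T -> V -> R) (a : V) (C r : R) :
  0 < r ->
  (forall v, mu.-integrable setT (fun x => (f x v)%:E)) ->
  (forall x, differentiable (f x) a) ->
  (forall x v, `|v - a| < r -> `|f x v - f x a| <= C * `|v - a|) ->
  differentiable (fun v => \int[mu]_x f x v) a /\
  forall h, 'd (fun v => \int[mu]_x f x v) a h = \int[mu]_x 'd (f x) a h.
Proof.
move=> r0 If df fC.
have mf v : measurable_fun setT (f^~ v).
  by apply/measurable_EFinP; exact: measurable_int (If v).
have mdf h : measurable_fun setT (fun x => 'd (f x) a h).
  exact: measurable_diff.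
have dfC x h : `|'d (f x) a h| <= C * `|h|.
  apply: normr_diff_le => //; apply/nbhs_ballP; exists r => // v.
  by rewrite -ball_normE /= distrC => /fC.
have Idf h : mu.-integrable setT (EFin \o (fun x => 'd (f x) a h)).
  exact: bounded_integrable.
pose D h := \int[mu]_x 'd (f x) a h.
have Dlin : linear D.
  move=> k u v; rewrite /D -[_ *: _ in RHS]/(_ * _) -RintegralZl//.
  rewrite -RintegralD//; last first.
    have -> : EFin \o (fun x => k * 'd (f x) a u) =
              EFin \o (fun x => 'd (f x) a (k *: u)).
      by apply/funext => x /=; rewrite linearZ.
    exact: Idf.
  by apply: eq_Rintegral => x _; rewrite linearP.
pose DlinM := GRing.isLinear.Build _ _ _ _ _ Dlin.
pose DL : {linear V -> R} := HB.pack D DlinM.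
have DLC : continuous DL.
  apply/linear_bounded_continuous.
  exists (`|C| * fine (mu setT)); split; first exact: num_real.
  move=> M CM; apply/nbhs_ballP; exists 1 => //= h.
  rewrite -ball_normE /= sub0r normrN => /ltW h1.
  have := normr_Rintegral_le mu (mdf h) (fun x => dfC x h).
  move=> /le_trans; apply; apply: le_trans (ltW CM).
  rewrite ler_wpM2r ?fine_ge0// (le_trans (ler_norm _))// normrM normr_id.
  by rewrite -[leRHS]mulr1 ler_wpM2l.
have DLo : (fun v => \int[mu]_x f x v) \o shift a =
    cst (\int[mu]_x f x a) + DL +o_ 0 id.
  apply/eqaddoP => e e0.
  pose q x h := f x (h + a) - f x a - 'd (f x) a h.
  have qC x h : `|h| < r -> `|q x h| <= (C + C) * `|h|.
    move=> hr; rewrite mulrDl; apply: le_trans (ler_normB _ _) _.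
    apply: lerD; last exact: dfC.
    by have := fC x (h + a); rewrite addrK => /(_ hr).
  have mq h : measurable_fun setT (q^~ h).
    by apply: measurable_funB => //; apply: measurable_funB.
  have qE h : (\int[mu]_x f x (h + a) - \int[mu]_x f x a - DL h) =
      \int[mu]_x q x h.
    rewrite -(RintegralB measurableT (If (h + a)) (If a)).
    rewrite -(RintegralB measurableT _ (Idf h))//.
    exact: (integrableB measurableT (If (h + a)) (If a)).
  apply: contrapT => nle.
  (* increments violating the bound with constant e, chosen to tend to 0 *)
  have /choice[h hP] : forall m : nat, exists v : V,
      [/\ `|v| < r, `|v| < m.+1%:R^-1 & e * `|v| < `|\int[mu]_x q x v|].
    move=> m; apply: contrapT => nex; apply: nle; apply/nbhs_ballP.
    exists (Num.min r m.+1%:R^-1); first by rewrite /= lt_min r0 invr_gt0 ltr0n.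
    move=> v; rewrite -ball_normE /= sub0r normrN lt_min => /andP[vr vm].
    rewrite leNgt; apply/negP => lth; apply: nex; exists v; split => //.
    by rewrite -qE; move: lth; rewrite !fctE /= opprD addrA.
  have h_gt0 m : 0 < `|h m|.
    rewrite normr_gt0; apply/eqP => h0; have [_ _] := hP m.
    have -> : \int[mu]_x q x (h m) = 0.
      by rewrite -qE h0 add0r subrr linear0 subrr.
    by rewrite h0 !normr0 mulr0 ltxx.
  have h0 : h @ \oo --> (0 : V).
    apply/cvgr0Pnorm_lt => eps eps0; near=> m.
    have [_ /lt_trans-> //] := hP m.
    by near: m; exact: near_infty_natSinv_lt (PosNum eps0).
  have u0 : `|h m|^-1 * \int[mu]_x q x (h m) @[m --> \oo] --> (0 : R).
    have -> : (fun m => `|h m|^-1 * \int[mu]_x q x (h m)) =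
        (fun m => \int[mu]_x (`|h m|^-1 * q x (h m))).
      apply/funext => m; rewrite RintegralZl//.
      by apply: bounded_integrable => // x; apply: qC; have [] := hP m.
    apply: (@bounded_Rintegral_cvg0 _ _ _ mu (fun m x => `|h m|^-1 * q x (h m))
      (C + C)) => [m|m x|x].
    - exact: measurable_funM.
    - rewrite normrM normfV normr_id ler_pdivrMl// mulrC.
      by apply: qC; have [] := hP m.
    - apply/cvgr0Pnorm_le => eps eps0.
      have /diff_locallyP[_ /eqaddoP/(_ _ eps0) oq] := df x.
      apply: (@filterS _ _ eventually_filter _ _ _ (h0 _ oq)) => m /=.
      rewrite !fctE /= opprD addrA => qle.
      by rewrite normrM normfV normr_id ler_pdivrMl// mulrC.
  move/cvgr0Pnorm_lt/(_ _ e0): u0 => [N _ /(_ N (leqnn N))] /=.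
  have [_ _] := hP N; rewrite normrM normfV normr_id ltr_pdivrMl// mulrC.
  by move=> /lt_trans/[apply]; rewrite ltxx.
have dE := diff_unique DLC DLo.
split; first by apply/diff_locallyP; rewrite dE.
by move=> h; rewrite dE.
Unshelve. all: by end_near. Qed.

(** On a convex domain the mean value inequality turns a bound on the
differentials of the integrand into the Lipschitz bounds needed above. *)
Section ConvexDomain.
Variables (f : T -> V -> R) (A : set V) (C : R).
Hypothesis convA : forall u v (t : R),
  A u -> A v -> 0 <= t <= 1 -> A (u + t *: (v - u)).
Hypothesis If : forall v, mu.-integrable setT (fun x => (f x v)%:E).
Hypothesis df : forall x v, A v -> differentiable (f x) v.
Hypothesis dfC : forall x v, A v -> forall h, `|'d (f x) v h| <= C * `|h|.

Let lipf x u v : A u -> A v -> `|f x v - f x u| <= C * `|v - u|.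
Proof.
move=> Au Av; apply: normr_subl_le_diff => t t01; [apply: df|apply: dfC];
  exact: convA.
Qed.

Lemma differentiable_Rintegral_in a :
  nbhs a A ->
  differentiable (fun v => \int[mu]_x f x v) a /\
  forall h, 'd (fun v => \int[mu]_x f x v) a h = \int[mu]_x 'd (f x) a h.
Proof.
move=> aA; have Aa := nbhs_singleton aA.
have /nbhs_ballP[r r0 ballA] := aA.
apply: (@differentiable_Rintegral f a C r) => // [x|x v vr].
  exact: df.
by apply: lipf => //; apply: ballA; rewrite -ball_normE /= distrC.
Qed.

Lemma lipschitz_Rintegral_in u v : A u -> A v ->
  `|\int[mu]_x f x v - \int[mu]_x f x u| <= C * fine (mu setT) * `|v - u|.
Proof.
move=> Au Av; rewrite -(RintegralB measurableT (If v) (If u)) mulrAC.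
apply: normr_Rintegral_le => [|x].
  have mf w : measurable_fun setT (f^~ w).
    by apply/measurable_EFinP; exact: measurable_int (If w).
  exact: measurable_funB.
exact: lipf.
Qed.

End ConvexDomain.

End DifferentiationUnderIntegral.

(** * Continuous functions are Borel measurable *)

Lemma continuous_measurable_borel (R : realType) (X : ptopologicalType)
    (f : X -> R) :
  continuous f -> measurable_fun setT (f : borelType X -> R).
Proof.
move=> /continuousP cf.
apply: (measurability _ (RGenOpens.measurableE R)) => _ [_ [a [b ->]] <-].
rewrite setTI; apply: sub_sigma_algebra; apply: cf; exact: interval_open.
Qed.

(** * The Lambert function on the nonnegative half-line *)

Section LambertW.
Context (R : realType).
Implicit Types u w z : R.

Lemma mulr_expR_lt z w : 0 <= z -> z < w -> z * expR z < w * expR w.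
Proof.
move=> z0 zw; apply: (@le_lt_trans _ _ (z * expR w)).
  by rewrite ler_wpM2l// ler_expR ltW.
by rewrite ltr_pM2r ?expR_gt0.
Qed.

Lemma mulr_expR_inj :
  {in [set z : R | 0 <= z] &, injective (fun z => z * expR z)}.
Proof.
move=> z w /[!inE] /= z0 w0 E; apply/eqP; rewrite eq_le !leNgt.
apply/andP; split; apply/negP.
- by move=> /(mulr_expR_lt w0); rewrite E ltxx.
- by move=> /(mulr_expR_lt z0); rewrite E ltxx.
Qed.

Lemma lambertWK z : 0 <= z -> lambertW (z * expR z) = z.
Proof.
move=> z0; rewrite /lambertW.
by apply: (pinvKV _ mulr_expR_inj); exact: mem_set.
Qed.

Lemma lambertW_surj u : 0 <= u -> exists2 z, 0 <= z & z * expR z = u.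
Proof.
move=> u0; have cf : {within `[0, u], continuous (fun z : R => z * expR z)}.
  apply: continuous_subspaceT => z; apply: cvgM; first exact: cvg_id.
  exact: continuous_expR.
have [|z] := @IVT R (fun z => z * expR z) 0 u u u0 cf.
  rewrite mul0r ge_min u0/= le_max; apply/orP; right.
  by rewrite ler_peMr// -expR0 ler_expR.
by rewrite in_itv/= => /andP[z0 _] <-; exists z.
Qed.

Lemma lambertW_ge0 u : 0 <= u -> 0 <= lambertW u.
Proof. by move=> /lambertW_surj[z z0 <-]; rewrite lambertWK. Qed.

Lemma lambertW_eq u : 0 <= u -> lambertW u * expR (lambertW u) = u.
Proof. by move=> /lambertW_surj[z z0 <-]; rewrite lambertWK. Qed.

Lemma lambertW_le u z : 0 <= u -> 0 <= z -> u <= z * expR z -> lambertW u <= z.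
Proof.
move=> u0 z0 uz; rewrite leNgt; apply/negP => /(mulr_expR_lt z0).
by rewrite lambertW_eq// ltNge uz.
Qed.

Lemma lambertW_gt0 u : 0 < u -> 0 < lambertW u.
Proof.
move=> u0; rewrite lt_neqAle lambertW_ge0 ?(ltW u0)// andbT eq_sym.
apply/eqP => W0; have := lambertW_eq (ltW u0).
by rewrite W0 mul0r => uE; move: u0; rewrite -uE ltxx.
Qed.

Lemma is_derive_lambertW u : 0 < u ->
  is_derive u 1 (@lambertW R) (expR (- lambertW u) / (1 + lambertW u)).
Proof.
move=> u0; set w := lambertW u; have w0 : 0 < w by exact: lambertW_gt0.
have dh (z : R) : is_derive z 1 (fun z => z * expR z) ((1 + z) * expR z).
  have := is_deriveM (is_derive_id z (1 : R)) (is_derive_expR z).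
  by move=> D; apply: is_derive_eq; rewrite /GRing.scale/=; ring.
have -> : expR (- w) / (1 + w) = ((1 + w) * expR w)^-1.
  by rewrite expRN invfM mulrC.
rewrite -(lambertW_eq (ltW u0)) -/w.
apply: (@is_derive_inverse _ (fun z => z * expR z) _ _ w) => //.
- near=> z; apply: lambertWK; apply: ltW; near: z; exact: lt_nbhsr.
- near=> z; apply: differentiable_continuous; apply/derivable1_diffP.
  exact: ex_derive.
- by rewrite mulf_neq0 ?gt_eqF ?expR_gt0// addr_gt0.
Unshelve. all: by end_near. Qed.

End LambertW.

(** * Differentials and norms on row vectors *)

Section RealValuedDifferentials.
Context (R : realType) (V : normedModType R).

Lemma is_diff_comp_derive (u du : V -> R) (p : R -> R) (l : R) (a : V) :
  is_diff a u du -> is_derive (u a) 1 p l ->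
  is_diff a (fun v => p (u v)) (fun h => l * du h).
Proof.
move=> Du [dp pE].
have Dp : is_diff (u a) p (fun t => l * t).
  apply: DiffDef; first exact/derivable1_diffP.
  rewrite diff1E; last exact/derivable1_diffP.
  by apply/funext => t; rewrite derive1E pE mulrC.
exact: (is_diff_comp Du Dp).
Qed.

Lemma is_diff_sum n (u du : 'I_n -> V -> R) (a : V) :
  (forall i, is_diff a (u i) (du i)) ->
  is_diff a (fun v => \sum_(i < n) u i v) (fun h => \sum_(i < n) du i h).
Proof.
move=> Du.
have sumE (f : 'I_n -> V -> R) :
    (fun v => \sum_(i < n) f i v) = \sum_(i < n) f i.
  by apply/funext => v; rewrite fct_sumE.
rewrite !sumE.
elim/big_ind2 : _ => //; first exact: is_diff_cst.
by move=> f df g dg; exact: is_diffD.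
Qed.

Lemma differentiable_row n (u : 'I_n -> V -> R) (a : V) :
  (forall i, differentiable (u i) a) ->
  differentiable (fun v => \row_(i < n) u i v) a.
Proof.
move=> du.
have -> : (fun v => \row_(i < n) u i v) =
    \sum_(i < n) (fun v => u i v *: (delta_mx 0 i : 'rV[R]_n)).
  apply/funext => v; rewrite fct_sumE [LHS]row_sum_delta.
  by apply: eq_bigr => i _; rewrite mxE.
by apply: differentiable_sum => i; exact: differentiableZl.
Qed.

End RealValuedDifferentials.

Section Coordinates.
Context (R : realType) (n : nat).

Lemma is_diff_coord (g : 'rV[R]_n) (j : 'I_n) :
  is_diff g (fun v : 'rV[R]_n => v 0 j) (fun h : 'rV[R]_n => h 0 j).
Proof.
apply: DiffDef; first exact: differentiable_coord.
have lin : linear (fun v : 'rV[R]_n => v 0 j) by move=> k u v; rewrite !mxE.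
pose linM := GRing.isLinear.Build _ _ _ _ _ lin.
pose L : {linear 'rV[R]_n -> R} := HB.pack (fun v : 'rV[R]_n => v 0 j) linM.
by rewrite (@diff_lin _ _ _ L)//; exact: coord_continuous.
Qed.

Lemma normr_coord_le (v : 'rV[R]_n) j : `|v 0 j| <= `|v|.
Proof.
by rewrite [leRHS]/Num.norm/= mx_normrE; exact: (le_bigmax _ _ (0, j)).
Qed.

Lemma normr_row_le (v : 'rV[R]_n) M :
  0 <= M -> (forall j, `|v 0 j| <= M) -> `|v| <= M.
Proof.
move=> M0 vM; rewrite [leLHS]/Num.norm/= mx_normrE.
by apply: bigmax_le => // -[i j] _ /=; rewrite ord1.
Qed.

Lemma normr_le_norm2 (v : 'rV[R]_n) : `|v| <= norm2 v.
Proof.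
apply: normr_row_le => [|j]; first exact: sqrtr_ge0.
rewrite -sqrtr_sqr ler_sqrt; last by apply: sumr_ge0 => i _; exact: sqr_ge0.
by rewrite (bigD1 j)//= lerDl sumr_ge0// => i _; exact: sqr_ge0.
Qed.

Lemma norm2_le_norm (v : 'rV[R]_n) : norm2 v <= n%:R * `|v|.
Proof.
have v0 : 0 <= n%:R * `|v| by rewrite mulr_ge0.
rewrite -[leRHS]ger0_norm// -sqrtr_sqr ler_sqrt ?sqr_ge0//.
apply: (@le_trans _ _ (\sum_(k < n) `|v| ^+ 2)).
  apply: ler_sum => k _; rewrite -real_normK ?num_real//.
  by rewrite lerXn2r ?nnegrE// normr_coord_le.
rewrite sumr_const card_ord -[_ *+ n]mulr_natl exprMn.
apply: ler_wpM2r; first exact: sqr_ge0.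
by rewrite -natrX ler_nat -mulnn; case: (n) => // m; rewrite leq_pmulr.
Qed.

End Coordinates.

(** * Transport terms with a general profile *)

(** The common shape of the two sources: both transport terms are, up to a
constant, integrals of [F (Z x g)] for a nonnegative [F] on the positive
half-line. The bound [t * |F2 t| <= F1 t] is invariant under rescaling of [t],
so that it survives where [Z] is close to 0; there the derivatives of a power
blow up, but [Z * F1 Z] and [Z ^ 2 * F2 Z] do not. *)
Record profile (R : realType) (F F1 F2 : R -> R) : Prop := Profile {
  profile_derive : forall t : R, 0 < t -> is_derive t 1 F (F1 t);
  profile_derive2 : forall t : R, 0 < t -> is_derive t 1 F1 (F2 t);
  profile_ge0 : forall t : R, 0 < t -> 0 <= F t;
  profile_derive2_le : forall t : R, 0 < t -> t * `|F2 t| <= F1 t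
}.

Section ProfileTheory.
Context (R : realType) (F F1 F2 : R -> R).
Hypothesis HF : profile F F1 F2.

Let nondecr_pos (p p' : R -> R) (s t : R) :
  (forall u : R, 0 < u -> is_derive u 1 p (p' u)) ->
  (forall u : R, 0 < u -> 0 <= p' u) -> 0 < s -> s <= t -> p s <= p t.
Proof.
move=> dp p'0 s0 st.
have pos (u : R) : u \in `[s, t] -> 0 < u.
  by rewrite in_itv/= => /andP[su _]; exact: lt_le_trans su.
have [u||u ust E] := @MVT_segment R p p' s t st.
- by move=> ust; apply: dp; apply: pos; exact: subset_itv_oo_cc.
- apply: derivable_within_continuous => u /pos u0.
  exact: (@ex_derive _ _ _ _ _ _ _ (dp u u0)).
- by rewrite -subr_ge0 E mulr_ge0 ?subr_ge0// p'0// pos.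
Qed.

Lemma profile_derive_ge0 t : 0 < t -> 0 <= F1 t.
Proof.
move=> t0; apply: le_trans (profile_derive2_le HF t0).
by rewrite mulr_ge0// ltW.
Qed.

Lemma profile_nondecr s t : 0 < s -> s <= t -> F s <= F t.
Proof. exact: nondecr_pos (profile_derive HF) profile_derive_ge0. Qed.

(** The derivative of [t * F1 t] is [F1 t + t * F2 t], which the bound on [F2]
keeps nonnegative. *)
Lemma profile_marginal_nondecr s t : 0 < s -> s <= t -> s * F1 s <= t * F1 t.
Proof.
apply: (@nondecr_pos (fun t => t * F1 t) (fun t => F1 t + t * F2 t)) => u u0.
  have D := is_deriveM (is_derive_id u (1 : R)) (profile_derive2 HF u0).
  by apply: (is_derive_eq D); rewrite /GRing.scale/=; ring.
have := profile_derive2_le HF u0; rewrite -{1}(gtr0_norm u0) -normrM.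
by move=> /ler_normlP[]; rewrite -subr_ge0 opprK addrC.
Qed.

End ProfileTheory.

Lemma Kset_convex (R : realType) (n : nat) (r d : R) (u v : 'rV[R]_n) (t : R) :
  Kset r d u -> Kset r d v -> 0 <= t <= 1 -> Kset r d (u + t *: (v - u)).
Proof.
move=> Ku Kv /andP[t0 t1] k; rewrite !mxE.
have -> : u 0 k + t * (v 0 k - u 0 k) = (1 - t) * u 0 k + t * v 0 k by ring.
have -> : r + d = (1 - t) * (r + d) + t * (r + d) by ring.
by rewrite lerD// ler_wpM2l ?subr_ge0.
Qed.

(** Enlarging the upper bound turns [Kset] into a neighborhood of its points;
differentiability on [Kset r d], which is closed, is obtained there from
estimates on [Kset r (d + 1)]. *)
Lemma Kset_nbhs (R : realType) (n : nat) (r d : R) (g : 'rV[R]_n) :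
  Kset r d g -> nbhs g (Kset r (d + 1)).
Proof.
move=> Kg; apply/nbhs_ballP; exists 1 => //= h.
rewrite -ball_normE /= => /ltW gh k; rewrite addrA.
have -> : h 0 k = g 0 k - (g - h) 0 k by rewrite !mxE; ring.
apply: lerD (Kg k) _; apply: le_trans (ler_norm _) _; rewrite normrN.
exact: le_trans (normr_coord_le _ _) gh.
Qed.

Lemma Kset_exists (R : realType) (n : nat) (r : R) (g : 'rV[R]_n) :
  exists d, Kset r d g.
Proof.
exists (`|g| - r) => k; rewrite addrC subrK.
exact: le_trans (ler_norm _) (normr_coord_le _ _).
Qed.

Section SemiDual.
Context (R : realType) (X : ptopologicalType) (Y : topologicalType).
Variable mu : {finite_measure set (borelType X) -> \bar R}.
Variables (n : nat) (beta : 'I_n -> R) (y : 'I_n -> Y) (c : X -> Y -> R).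
Variables (eps r : R).
Hypotheses (n_gt0 : (0 < n)%N) (beta_gt0 : forall j, 0 < beta j).
Hypotheses (c_ge0 : forall x z, 0 <= c x z).
Hypothesis c_cont : continuous (fun p : X * Y => c p.1 p.2).
Hypothesis eps_gt0 : 0 < eps.
Variables (F F1 F2 : R -> R).
Hypothesis HF : profile F F1 F2.

Implicit Types (x : X) (g h : 'rV[R]_n) (d : R).

Local Notation Bj := (termB beta y c eps).
Local Notation Z := (sumZ beta y c eps).

Let B_gt0 x g j : 0 < Bj x g j.
Proof. by rewrite mulr_gt0 ?expR_gt0. Qed.

Let B_le_Z x g j : Bj x g j <= Z x g.
Proof. by rewrite /sumZ (bigD1 j)//= lerDl sumr_ge0// => i _; exact: ltW. Qed.

Let Z_gt0 x g : 0 < Z x g.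
Proof. exact: lt_le_trans (B_gt0 x g (Ordinal n_gt0)) (B_le_Z x g _). Qed.

(** Upper bound of [Z x] on [Kset r d]. *)
Definition Zbound d := (\sum_(j < n) beta j) * expR ((r + d) / eps).

Let Z_le d x g : Kset r d g -> Z x g <= Zbound d.
Proof.
move=> Kg; rewrite /Zbound mulr_suml; apply: ler_sum => j _.
rewrite ler_pM2l// ler_expR ler_pM2r ?invr_gt0//.
by apply: le_trans (Kg j); rewrite gerBl.
Qed.

Let B_cont g j : continuous (fun x => Bj x g j).
Proof.
move=> x; apply: cvgM; first exact: cvg_cst.
apply: (@continuous_comp _ _ _ (fun x => (g 0 j - c x (y j)) / eps) (@expR R));
  last exact: continuous_expR.
apply: cvgM; last exact: cvg_cst.
apply: cvgB; first exact: cvg_cst.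
apply: (@continuous_comp _ _ _ (fun x => (x, y j))
          (fun p : X * Y => c p.1 p.2));
  last exact: c_cont.
by apply: cvg_pair => /=; [exact: cvg_id|exact: cvg_cst].
Qed.

Let Z_cont g : continuous (Z^~ g).
Proof.
move=> x; apply: cvg_big => [|j _]; first exact: add_continuous.
exact: B_cont.
Qed.

Let comp_cont (p p' : R -> R) g :
  (forall t : R, 0 < t -> is_derive t 1 p (p' t)) ->
  continuous (fun x => p (Z x g)).
Proof.
move=> dp x; apply: (@continuous_comp _ _ _ (Z^~ g) p); first exact: Z_cont.
apply: differentiable_continuous; apply/derivable1_diffP.
by have [] := dp _ (Z_gt0 x g).
Qed.

Definition dsumZ x g h := \sum_(j < n) Bj x g j * (h 0 j / eps).

Let diff_B x g j :
  is_diff g (fun v => Bj x v j) (fun h => Bj x g j * (h 0 j / eps)).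
Proof.
have dp : is_derive (g 0 j) 1
    (fun t => beta j * expR ((t - c x (y j)) / eps)) (Bj x g j / eps).
  have D : is_derive (g 0 j) 1 (fun t => (t - c x (y j)) / eps) (eps^-1).
    by apply: is_derive_eq; rewrite subr0 !scaler0 add0r /GRing.scale/= mulr1.
  have := is_deriveZ (beta j) (is_derive1_comp (is_derive_expR _) D).
  by move=> E; apply: is_derive_eq; rewrite /GRing.scale/= /termB; ring.
have := is_diff_comp_derive (is_diff_coord g j) dp.
by under [X in is_diff _ _ X -> _]funext do rewrite -mulrA (mulrC eps^-1).
Qed.

Let diff_Z x g : is_diff g (Z x) (dsumZ x g).
Proof. by apply: is_diff_sum => j; exact: diff_B. Qed.

Let diff_F x g :
  is_diff g (fun v => F (Z x v)) (fun h => F1 (Z x g) * dsumZ x g h).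
Proof.
exact: is_diff_comp_derive (diff_Z x g) (profile_derive HF (Z_gt0 x g)).
Qed.

(** The derivative of [F (Z x g)] in [g_k]. *)
Definition partialF k x g := F1 (Z x g) * (Bj x g k / eps).

Let diff_partialF k x g :
  is_diff g (partialF k x)
    (fun h => F2 (Z x g) * dsumZ x g h * (Bj x g k / eps) +
              F1 (Z x g) * (Bj x g k * (h 0 k / eps) / eps)).
Proof.
have D1 := is_diff_comp_derive (diff_Z x g) (profile_derive2 HF (Z_gt0 x g)).
have D2 := is_diffM D1 (is_diffZ eps^-1 (diff_B x g k)).
have -> : partialF k x = (fun v => F1 (Z x v)) * (eps^-1 *: Bj x ^~ k).
  by apply/funext => v; rewrite /partialF mulrC (mulrC (Bj x v k)) mulrC.
apply: is_diff_eq D2 _.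
apply/funext => h; rewrite !fctE /GRing.scale/=; ring.
Qed.

Let dsumZ_le x g h : `|dsumZ x g h| <= Z x g * (`|h| / eps).
Proof.
apply: le_trans (ler_norm_sum _ _ _) _; rewrite mulr_suml ler_sum// => j _.
rewrite normrM (gtr0_norm (B_gt0 _ _ _)) ler_pM2l// normrM.
rewrite (gtr0_norm (x := eps^-1)) ?invr_gt0// ler_pM2r ?invr_gt0//.
exact: normr_coord_le.
Qed.

(** Upper bound on [Kset r d] of [Z * F1 Z], which is [eps] times the sum over
[k] of the derivatives of [F (Z x g)] in [g_k]. *)
Definition marginal_bound d := Zbound d * F1 (Zbound d).

Let E_le d x g : Kset r d g -> Z x g * F1 (Z x g) <= marginal_bound d.
Proof.
by move=> Kg; apply: (profile_marginal_nondecr HF) => //; exact: Z_le.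
Qed.

Let diff_F_le d x g h : Kset r d g ->
  `|F1 (Z x g) * dsumZ x g h| <= marginal_bound d / eps * `|h|.
Proof.
move=> Kg; have f0 := profile_derive_ge0 HF (Z_gt0 x g).
rewrite normrM (ger0_norm f0).
apply: le_trans (ler_wpM2l f0 (dsumZ_le x g h)) _.
rewrite mulrA (mulrC (F1 _)) -[leRHS]mulrA (mulrC eps^-1).
by rewrite ler_wpM2r ?mulr_ge0 ?invr_ge0 ?(ltW eps_gt0)// E_le.
Qed.

(** Each of the two terms is at most [F1 Z * B_k * |h| / eps ^ 2]: the first one
because [|F2 Z| * Z <= F1 Z]. As [B_k <= Z], this is controlled by
[Z * F1 Z]. *)
Let diff_partialF_le d k x g h : Kset r d g ->
  `|F2 (Z x g) * dsumZ x g h * (Bj x g k / eps) +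
              F1 (Z x g) * (Bj x g k * (h 0 k / eps) / eps)|
  <= 2 * marginal_bound d / eps ^+ 2 * `|h|.
Proof.
move=> Kg; have f0 := profile_derive_ge0 HF (Z_gt0 x g).
have e0 : 0 <= eps^-1 by rewrite invr_ge0 ltW.
have f2 : `|F2 (Z x g)| * Z x g <= F1 (Z x g).
  by rewrite mulrC; exact: (profile_derive2_le HF).
have -> : 2 * marginal_bound d / eps ^+ 2 * `|h| =
    marginal_bound d * (`|h| / eps / eps) +
    marginal_bound d * (`|h| / eps / eps).
  by field; rewrite gt_eqF.
have hee : 0 <= `|h| / eps / eps by rewrite mulr_ge0// mulr_ge0.
have main : F1 (Z x g) * Bj x g k * (`|h| / eps / eps) <=
    marginal_bound d * (`|h| / eps / eps).
  rewrite ler_wpM2r// (le_trans _ (E_le x Kg))// mulrC ler_wpM2r//.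
apply: le_trans (ler_normD _ _) _; apply: lerD; apply: le_trans main.
- have Be : 0 <= Bj x g k / eps by rewrite mulr_ge0// ltW.
  rewrite 2!normrM (ger0_norm Be).
  have -> : F1 (Z x g) * Bj x g k * (`|h| / eps / eps) =
      F1 (Z x g) * (`|h| / eps) * (Bj x g k / eps) by ring.
  rewrite ler_wpM2r//.
  apply: le_trans (ler_wpM2l (normr_ge0 _) (dsumZ_le x g h)) _.
  by rewrite mulrA ler_wpM2r// mulr_ge0.
- have -> : F1 (Z x g) * (Bj x g k * (h 0 k / eps) / eps) =
      F1 (Z x g) * Bj x g k / eps / eps * h 0 k by ring.
  have -> : F1 (Z x g) * Bj x g k * (`|h| / eps / eps) =
      F1 (Z x g) * Bj x g k / eps / eps * `|h| by ring.
  have f0B : 0 <= F1 (Z x g) * Bj x g k / eps / eps.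
    by do 2![rewrite mulr_ge0//]; rewrite mulr_ge0// ltW.
  by rewrite normrM (ger0_norm f0B) ler_wpM2l// normr_coord_le.
Qed.

Let F_integrable g : mu.-integrable setT (fun x => (F (Z x g))%:E).
Proof.
have [d Kg] := Kset_exists r g.
apply: (@bounded_integrable _ _ _ mu _ (F (Zbound d))).
  by apply: continuous_measurable_borel; exact: comp_cont (profile_derive HF).
move=> x; rewrite ger0_norm ?(profile_ge0 HF)//.
by apply: (profile_nondecr HF) => //; exact: Z_le.
Qed.

Let partialF_cont k g : continuous (partialF k ^~ g).
Proof.
move=> x; apply: cvgM; first exact: (comp_cont (profile_derive2 HF)).
by apply: cvgM; [exact: B_cont|exact: cvg_cst].
Qed.

Let partialF_integrable k g :
  mu.-integrable setT (fun x => (partialF k x g)%:E).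
Proof.
have [d Kg] := Kset_exists r g.
apply: (@bounded_integrable _ _ _ mu _ (marginal_bound d / eps)).
  by apply: continuous_measurable_borel; exact: partialF_cont.
have f0 x := profile_derive_ge0 HF (Z_gt0 x g).
move=> x; rewrite ger0_norm; last by rewrite !mulr_ge0 ?invr_ge0// ltW.
rewrite /partialF mulrA ler_pM2r ?invr_gt0//.
by rewrite (le_trans _ (E_le x Kg))// mulrC ler_wpM2r.
Qed.

Let dsumZ_cont g h : continuous (fun x => dsumZ x g h).
Proof.
move=> x; apply: cvg_big => [|j _]; first exact: add_continuous.
by apply: cvgM; [exact: B_cont|exact: cvg_cst].
Qed.

Local Notation I := (fun g => \int[mu]_x F (Z x g)).

Let diff_I g :
  differentiable I g /\
  forall h, 'd I g h = \int[mu]_x (F1 (Z x g) * dsumZ x g h).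
Proof.
have [d Kg] := Kset_exists r g.
have dE x v : 'd (fun v => F (Z x v)) v =
    (fun h => F1 (Z x v) * dsumZ x v h) :> (_ -> _).
  by have [_ ->] := diff_F x v.
have [||dI IE] := @differentiable_Rintegral_in _ _ _ _ mu (fun x v => F (Z x v))
  (Kset r (d + 1)) (marginal_bound (d + 1) / eps) (@Kset_convex _ _ _ _)
  F_integrable _ _ g (Kset_nbhs Kg).
- by move=> x v _; have [] := diff_F x v.
- by move=> x v Kv h; rewrite dE diff_F_le.
- split => // h; rewrite IE; apply: eq_Rintegral => x _; by rewrite dE.
Qed.

Let diff_gradI k g : differentiable (fun g => \int[mu]_x partialF k x g) g.
Proof.
have [d Kg] := Kset_exists r g.
have dE x v := diff_val (is_diff_def := diff_partialF k x v).
have [||] := @differentiable_Rintegral_in _ _ _ _ mu (partialF k)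
  (Kset r (d + 1)) (2 * marginal_bound (d + 1) / eps ^+ 2)
  (@Kset_convex _ _ _ _)
  (partialF_integrable k) _ _ g (Kset_nbhs Kg).
- by move=> x v _; have [] := diff_partialF k x v.
- by move=> x v Kv h; rewrite dE diff_partialF_le.
- by [].
Qed.

Lemma differentiable_semidual g : differentiable I g.
Proof. by have [] := diff_I g. Qed.

Lemma gradient_semidual :
  gradient I = fun g => \row_k \int[mu]_x partialF k x g.
Proof.
apply/funext => g; apply/rowP => k; rewrite !mxE.
have [dI IE] := diff_I g; rewrite deriveE// IE.
apply: eq_Rintegral => x _; congr (_ * _).
rewrite /dsumZ (bigD1 k)//= big1 => [|j jk]; last first.
  by rewrite mxE (negPf jk) andbF mul0r mulr0.
by rewrite mxE !eqxx addr0 mul1r.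
Qed.

Lemma differentiable_gradient_semidual g : differentiable (gradient I) g.
Proof. by rewrite gradient_semidual; apply: differentiable_row => k. Qed.

(** The entries of the gradient are nonnegative, so that their sum is the
differential in the direction with all entries equal to 1. *)
Lemma norm1_gradient_semidual_le d g : Kset r d g ->
  norm1 (gradient I g) <= marginal_bound d / eps * fine (mu setT).
Proof.
move=> Kg; have [dI IE] := diff_I g.
have -> : norm1 (gradient I g) = 'd I g (const_mx 1).
  rewrite [const_mx 1]row_sum_delta linear_sum; apply: eq_bigr => k _.
  rewrite [in RHS]mxE scale1r -deriveE// ger0_norm; first by rewrite mxE.
  rewrite gradient_semidual mxE; apply: Rintegral_ge0 => x _.
  have f0 := profile_derive_ge0 HF (Z_gt0 x g).
  by rewrite !mulr_ge0 ?invr_ge0// ltW.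
rewrite IE; apply: le_trans (ler_norm _) _; apply: normr_Rintegral_le.
  apply: continuous_measurable_borel => x; apply: cvgM; last exact: dsumZ_cont.
  exact: (comp_cont (profile_derive2 HF)).
move=> x; apply: le_trans (diff_F_le _ _ Kg) _.
have E0 : 0 <= marginal_bound d.
  apply: le_trans (E_le x Kg); rewrite mulr_ge0 ?(ltW (Z_gt0 _ _))//.
  exact: (profile_derive_ge0 HF).
have C0 : 0 <= marginal_bound d / eps by apply: divr_ge0 => //; exact: ltW.
rewrite -[leRHS]mulr1; apply: ler_wpM2l => //.
by apply: normr_row_le => // j; rewrite mxE normr1.
Qed.

Lemma lipschitz_gradient_semidual d u v : Kset r d u -> Kset r d v ->
  `|gradient I v - gradient I u| <=
    2 * marginal_bound d / eps ^+ 2 * fine (mu setT) * `|v - u|.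
Proof.
move=> Ku Kv; rewrite gradient_semidual.
have lipk k : `|\int[mu]_x partialF k x v - \int[mu]_x partialF k x u| <=
    2 * marginal_bound d / eps ^+ 2 * fine (mu setT) * `|v - u|.
  apply: (@lipschitz_Rintegral_in _ _ _ _ mu (partialF k) (Kset r d)) => //.
  - exact: Kset_convex.
  - by move=> x w _; have [] := diff_partialF k x w.
  - move=> x w Kw h; rewrite (diff_val (is_diff_def := diff_partialF k x w)).
    exact: diff_partialF_le.
apply: normr_row_le => [|k]; last by rewrite !mxE.
exact: le_trans (normr_ge0 _) (lipk (Ordinal n_gt0)).
Qed.

End SemiDual.

(** * The profiles of the KL and chi-square sources *)

Lemma profile_powR (R : realType) (a : R) : 0 < a <= 1 ->
  profile (fun t => t `^ a) (fun t => a * t `^ (a - 1))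
    (fun t => a * ((a - 1) * t `^ (a - 1 - 1))).
Proof.
move=> /andP[a0 a1].
have pB t p : 0 < t -> t * t `^ (p - 1) = t `^ p.
  move=> t0; rewrite powRB; last by rewrite (gt_eqF t0) implybT.
  by rewrite powRr1 ?(ltW t0)// mulrC divfK// gt_eqF.
split => [t t0|t t0|t t0|t t0].
- exact: is_derive1_powR.
- exact: (is_deriveZ a (is_derive1_powR (a - 1) t0)).
- exact: powR_ge0.
- have -> : a * ((a - 1) * t `^ (a - 1 - 1)) =
      - (a * (1 - a) * t `^ (a - 1 - 1)) by ring.
  rewrite normrN ger0_norm; last by rewrite !mulr_ge0 ?powR_ge0 ?subr_ge0// ltW.
  have -> : t * (a * (1 - a) * t `^ (a - 1 - 1)) =
    a * (1 - a) * (t * t `^ (a - 1 - 1)) by ring.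
  rewrite pB// ler_wpM2r ?powR_ge0// ler_piMr ?(ltW a0)//.
  by rewrite lerBlDr lerDl ltW.
Qed.

(** From [W * exp W = a * t] and [W' = exp (- W) / (1 + W)], the factor [1 + W]
produced by differentiating [W + W ^ 2 / 2] cancels, which leaves
[a * exp (- W)]; the ratio [t * |F2 t| / F1 t] is [W / (1 + W)]. *)
Lemma profile_lambertW (R : realType) (a : R) : 0 < a ->
  profile (fun t => lambertW (a * t) + lambertW (a * t) ^+ 2 / 2)
    (fun t => a * expR (- lambertW (a * t)))
    (fun t => - (a ^+ 2 * expR (- lambertW (a * t)) ^+ 2 /
                 (1 + lambertW (a * t)))).
Proof.
move=> a0; have at0 t : 0 < t -> 0 < a * t by exact: mulr_gt0.
pose W := @lambertW R.
have W0 t : 0 < t -> 0 < W (a * t) by move=> t0; exact/lambertW_gt0/at0.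
have WE t : 0 < t -> a * t * expR (- W (a * t)) = W (a * t).
  move=> t0; rewrite -[X in X * _](lambertW_eq (ltW (at0 _ t0))) -mulrA -expRD.
  by rewrite subrr expR0 mulr1.
have dW (t : R) : 0 < t -> is_derive t 1 (fun t => W (a * t))
    (a * expR (- W (a * t)) / (1 + W (a * t))).
  move=> t0.
  have D : is_derive t 1 (fun t => a * t) a.
    by apply: is_derive_eq; rewrite /GRing.scale/= mulr1.
  have := is_derive1_comp (is_derive_lambertW (at0 _ t0)) D.
  by move=> E; apply: (is_derive_eq E); rewrite /GRing.scale/= /W; ring.
split => [t t0|t t0|t t0|t t0].
- have D := dW t t0.
  have := is_deriveD D (is_deriveZ 2^-1 (is_deriveX 2 D)).
  have W1 : 1 + W (a * t) != 0 by rewrite gt_eqF// addr_gt0// W0.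
  move=> E; have -> : (fun t => lambertW (a * t) + lambertW (a * t) ^+ 2 / 2) =
      (fun t => W (a * t)) + 2^-1 *: (fun t => W (a * t)) ^+ 2.
    by apply/funext => s; rewrite [_ / 2]mulrC.
  by apply: (is_derive_eq E); rewrite /GRing.scale/= /W; field; exact: W1.
- have E := is_deriveZ a
    (is_derive1_comp (is_derive_expR _) (is_deriveN (dW t t0))).
  have W1 : 1 + W (a * t) != 0 by rewrite gt_eqF// addr_gt0// W0.
  by apply: (is_derive_eq E); rewrite /GRing.scale/= fctE /W; field; exact: W1.
- by rewrite addr_ge0 ?divr_ge0 ?sqr_ge0// ltW// W0.
- have W1 : 0 < 1 + W (a * t) by rewrite addr_gt0// W0.
  rewrite normrN ger0_norm; last first.
    by rewrite divr_ge0 ?(ltW W1)// mulr_ge0 ?sqr_ge0.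
  have -> : t * (a ^+ 2 * expR (- lambertW (a * t)) ^+ 2 /
                 (1 + lambertW (a * t))) =
       a * expR (- W (a * t)) *
       (a * t * expR (- W (a * t)) / (1 + W (a * t))) by rewrite /W; ring.
  rewrite WE// ler_piMr ?mulr_ge0 ?expR_ge0 ?(ltW a0)//.
  by rewrite ler_pdivrMr// mul1r lerDr.
Qed.

(** * Functions with a Lipschitz gradient on the sets Kset *)

Section GradientAlgebra.
Context (R : realType) (n : nat).
Implicit Types (f q : 'rV[R]_n -> R) (g : 'rV[R]_n).

Lemma gradientD f q g : differentiable f g -> differentiable q g ->
  gradient (fun v => f v + q v) g = gradient f g + gradient q g.
Proof.
move=> df dq; apply/rowP => k; rewrite !mxE.
by apply: deriveD; exact: diff_derivable.
Qed.

Lemma gradientZ (a : R) f g : differentiable f g ->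
  gradient (fun v => a * f v) g = a *: gradient f g.
Proof.
move=> df; apply/rowP => k; rewrite !mxE.
by apply: (deriveZ a); exact: diff_derivable.
Qed.

Lemma gradient_diff f (df : 'I_n -> R) g :
  is_diff g f (fun h => \sum_(j < n) df j * h 0 j) ->
  gradient f g = \row_k df k.
Proof.
move=> [dfg E]; apply/rowP => k; rewrite !mxE deriveE// E (bigD1 k)//=.
rewrite big1 => [|j jk]; last by rewrite mxE (negPf jk) andbF mulr0.
by rewrite mxE !eqxx addr0 mulr1.
Qed.

End GradientAlgebra.

(** Indexing the Lipschitz constant by [d] keeps the information on a
neighborhood of each [Kset r d], and makes the property stable under sums and
nonnegative multiples. *)
Record smooth_below (R : realType) (n : nat) (r : R) (L : R -> R)
    (f : 'rV[R]_n -> R) : Prop := SmoothBelow {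
  smooth_below_diff : forall g, differentiable f g;
  smooth_below_diff_gradient : forall g, differentiable (gradient f) g;
  smooth_below_lipschitz : forall (d : R) u v, Kset r d u -> Kset r d v ->
    `|gradient f v - gradient f u| <= L d * `|v - u|
}.

Section SmoothBelowTheory.
Context (R : realType) (n : nat) (r : R).
Implicit Types (f q : 'rV[R]_n -> R) (L M : R -> R).

Lemma smooth_belowD L M f q : smooth_below r L f -> smooth_below r M q ->
  smooth_below r (fun d => L d + M d) (fun v => f v + q v).
Proof.
move=> [df ddf lf] [dq ddq lq].
have E : gradient (fun v => f v + q v) = gradient f + gradient q.
  by apply/funext => g; rewrite gradientD.
split => [g|g|d u v Ku Kv].
- exact: differentiableD.
- by rewrite E; exact: differentiableD.
- rewrite E !fctE opprD addrACA mulrDl.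
  by apply: le_trans (ler_normD _ _) (lerD _ _); [exact: lf|exact: lq].
Qed.

Lemma smooth_belowZ (a : R) L f : 0 <= a -> smooth_below r L f ->
  smooth_below r (fun d => a * L d) (fun v => a * f v).
Proof.
move=> a0 [df ddf lf].
have E : gradient (fun v => a * f v) = a *: gradient f.
  by apply/funext => g; rewrite gradientZ.
split => [g|g|d u v Ku Kv].
- exact: differentiableZ.
- by rewrite E; exact: differentiableZ.
- rewrite E !fctE -scalerBr normrZ (ger0_norm a0) -mulrA.
  by rewrite ler_wpM2l// lf.
Qed.

Lemma smooth_below_ext L M f : L =1 M ->
  smooth_below r L f -> smooth_below r M f.
Proof. by move=> /funext ->. Qed.

Lemma smooth_below_penalty (beta : 'I_n -> R) (rho : R) :
  (forall j, 0 < beta j) -> 0 < rho ->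
  smooth_below r (fun=> (\sum_j beta j) / rho)
    (fun g => \sum_(j < n) beta j * (g 0 j ^+ 2 / (2 * rho) - g 0 j)).
Proof.
move=> b0 rho0.
have D (g : 'rV[R]_n) : is_diff g
    (fun g => \sum_(j < n) beta j * (g 0 j ^+ 2 / (2 * rho) - g 0 j))
    (fun h => \sum_(j < n) beta j * (g 0 j / rho - 1) * h 0 j).
  apply: is_diff_sum => j.
  apply: (is_diff_comp_derive (p := fun t => beta j * (t ^+ 2 / (2 * rho) - t))
    (is_diff_coord g j)).
  have E (t : R) := is_deriveZ (beta j) (is_deriveB
    (is_deriveZ (2 * rho)^-1 (is_deriveX 2 (is_derive_id t (1 : R))))
    (is_derive_id t (1 : R))).
  have -> : (fun t => beta j * (t ^+ 2 / (2 * rho) - t)) =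
      beta j \*: ((2 * rho)^-1 \*: (id : R -> R) ^+ 2 - id).
    by apply/funext => t /=; rewrite !fctE [_ / _]mulrC.
  apply: (is_derive_eq (E _)); rewrite /GRing.scale/=; field.
  by rewrite gt_eqF.
have G : gradient
      (fun g => \sum_(j < n) beta j * (g 0 j ^+ 2 / (2 * rho) - g 0 j)) =
    fun g => \row_k (beta k * (g 0 k / rho - 1)).
  by apply/funext => g; rewrite (gradient_diff (D g)).
split => [g|g|d u v _ _].
- by have [] := D g.
- rewrite G; apply: differentiable_row => k.
  suff H : is_derive (g 0 k) 1 (fun t => beta k * (t / rho - 1)) (beta k / rho).
    by have [] := is_diff_comp_derive (is_diff_coord g k) H.
  have E := is_deriveZ (beta k) (is_deriveB
    (is_deriveZ rho^-1 (is_derive_id (g 0 k) (1 : R)))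
    (is_derive_cst (1 : R) (g 0 k) (1 : R))).
  have -> : (fun t => beta k * (t / rho - 1)) =
      beta k \*: (rho^-1 \*: (id : R -> R) - cst 1).
    by apply/funext => t /=; rewrite !fctE [_ / _]mulrC.
  by apply: (is_derive_eq E); rewrite /GRing.scale/= subr0 mulr1.
- rewrite G; apply: normr_row_le => [|k].
    by rewrite mulr_ge0// divr_ge0 ?(ltW rho0)// sumr_ge0// => j _; exact: ltW.
  rewrite !mxE.
  have -> : beta k * (v 0 k / rho - 1) - beta k * (u 0 k / rho - 1) =
    beta k / rho * (v - u) 0 k by rewrite !mxE; ring.
  have bk : 0 <= beta k / rho by rewrite divr_ge0// ltW.
  rewrite normrM (ger0_norm bk); apply: ler_pM => //.
    rewrite ler_pM2r ?invr_gt0// (bigD1 k)//= lerDl.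
    by rewrite sumr_ge0// => j _; exact: ltW.
  exact: normr_coord_le.
Qed.

Lemma smooth_below_twice_differentiable L f g :
  smooth_below r L f -> twice_differentiable f g.
Proof.
move=> [df ddf _]; split; last exact: ddf.
by near=> h; exact: df.
Unshelve. all: by end_near. Qed.

(** The differential of a map which is [L]-Lipschitz near a point has operator
norm at most [L], and the Lipschitz constant on [Kset r (d + 1)] serves at
every point of [Kset r d]. *)
Lemma smooth_below_hessian L f d : smooth_below r L f ->
  [bounded hessian f g | g in Kset r d].
Proof.
move=> [df ddf lf]; exists `|L (d + 1)|; split; first exact: num_real.
move=> M LM g Kg.
rewrite /= [leLHS]/Num.norm/= mx_normrE; apply: bigmax_le => [|[i j] _ /=].
  exact: le_trans (normr_ge0 _) (ltW LM).
have /(_ (delta_mx 0 i)) H :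
    forall h, `|'d (gradient f) g h| <= L (d + 1) * `|h|.
  apply: normr_diff_le => //; have Kn := Kset_nbhs Kg.
  apply: filterS Kn => v Kv; apply: lf => // k.
  by apply: le_trans (Kg k) _; rewrite lerD2l lerDl.
rewrite /hessian /jacobian mxE.
apply: le_trans (normr_coord_le _ _) _; apply: le_trans H _.
apply: le_trans (ltW LM); apply: le_trans (ler_norm _) _.
rewrite normrM normr_id -[leRHS]mulr1 ler_wpM2l//.
apply: normr_row_le => // k; rewrite mxE.
by case: (_ && _); rewrite ?normr1 ?normr0.
Qed.

Lemma smooth_below_smooth_on L f d : smooth_below r L f -> 0 <= L d ->
  smooth_on (n%:R * L d) f (Kset r d).
Proof.
move=> [df ddf lf] L0; split => // g h Kg Kh.
apply: le_trans (norm2_le_norm _) _; rewrite -mulrA ler_wpM2l//.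
by apply: le_trans (lf _ _ _ Kh Kg) _; rewrite ler_wpM2l// normr_le_norm2.
Qed.

End SmoothBelowTheory.

(** * The transport term and the semi-dual objective *)

Section Transport.
Context (R : realType) (X : ptopologicalType) (Y : topologicalType).
Variable mu : {finite_measure set (borelType X) -> \bar R}.
Variables (n : nat) (beta : 'I_n -> R) (y : 'I_n -> Y) (c : X -> Y -> R).
Variables (rho1 rho2 : R).
Hypotheses (n_gt0 : (0 < n)%N) (beta_gt0 : forall j, 0 < beta j).
Hypotheses (c_ge0 : forall x z, 0 <= c x z).
Hypothesis c_cont : continuous (fun p : X * Y => c p.1 p.2).
Hypotheses (rho1_gt0 : 0 < rho1).
Implicit Types (s : source) (eps d : R).

Let mass := \sum_(j < n) beta j.

Let mass_ge0 : 0 <= mass.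
Proof. by apply: sumr_ge0 => j _; exact: ltW. Qed.

(** The two constants agree because [t * F1 t] is [alpha * t ^ alpha] for the KL
source, with [(rho1 + eps) * alpha = eps], and [W (a * t)] for the chi-square
source. *)
Lemma Jtrans_profile s eps : 0 < eps -> exists kappa F F1 F2,
  [/\ 0 < kappa, profile F F1 F2,
      Jtrans s mu beta y c eps rho1 =
        (fun g => kappa * \int[mu]_x F (sumZ beta y c eps x g)) &
      forall d, kappa * (marginal_bound beta eps rho2 F1 d * fine (mu setT)) =
                eps * Cbound s mu beta eps rho1 rho2 d].
Proof.
move=> eps0; have er0 : 0 < eps + rho1 by exact: addr_gt0.
have re0 : 0 < rho1 + eps by exact: addr_gt0.
case: s.
- pose a := alpha eps rho1.
  have a01 : 0 < a <= 1.
    by rewrite divr_gt0//= ler_pdivrMr// mul1r lerDl ltW.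
  exists (rho1 + eps); do 3 eexists; split.
  + exact: re0.
  + exact: profile_powR a01.
  + by [].
  + move=> d; rewrite /marginal_bound /=.
    have Z0 : 0 < Zbound beta eps rho2 d.
      rewrite mulr_gt0 ?expR_gt0// (bigD1 (Ordinal n_gt0))//=.
      by rewrite ltr_wpDr// sumr_ge0// => j _; exact: ltW.
    have -> : Zbound beta eps rho2 d * (a * Zbound beta eps rho2 d `^ (a - 1)) =
        a * Zbound beta eps rho2 d `^ a.
      rewrite mulrCA mulr_powRB1 ?(ltW Z0)//; by case/andP: a01.
    have -> : Zbound beta eps rho2 d `^ a =
        mass `^ a * expR ((rho2 + d) / (rho1 + eps)).
      rewrite powRM ?expR_ge0// -expRM; congr (_ * expR _).
      by rewrite /a /alpha; field; rewrite !gt_eqF.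
    by rewrite -/a /a /alpha; field; rewrite gt_eqF.
- pose a := rho1 / eps * expR (rho1 / eps).
  have a0 : 0 < a by rewrite mulr_gt0 ?expR_gt0 ?divr_gt0.
  exists (eps ^+ 2 / rho1); do 3 eexists; split.
  + by rewrite divr_gt0// exprn_gt0.
  + exact: profile_lambertW a0.
  + by [].
  + move=> d; rewrite /marginal_bound /=.
    have Z0 : 0 <= Zbound beta eps rho2 d by rewrite mulr_ge0 ?expR_ge0.
    have aZ0 : 0 <= a * Zbound beta eps rho2 d by rewrite mulr_ge0// ltW.
    have -> : Zbound beta eps rho2 d *
        (a * expR (- lambertW (a * Zbound beta eps rho2 d))) =
        lambertW (a * Zbound beta eps rho2 d).
      rewrite mulrA (mulrC _ a) -[X in X * _](lambertW_eq aZ0) -mulrA -expRD.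
      by rewrite subrr expR0 mulr1.
    rewrite /Zbound mulrA -/a -/mass; field; by rewrite gt_eqF.
Qed.

Lemma differentiable_Jtrans s eps g : 0 < eps ->
  differentiable (Jtrans s mu beta y c eps rho1) g.
Proof.
move=> eps0; have [kappa [F [F1 [F2 [k0 HF -> _]]]]] := Jtrans_profile s eps0.
apply: (differentiableZ kappa).
exact: (differentiable_semidual mu y rho2 n_gt0 beta_gt0 c_ge0 c_cont eps0 HF).
Qed.

Lemma norm1_gradient_Jtrans_le s eps d g : 0 < eps -> Kset rho2 d g ->
  norm1 (gradient (Jtrans s mu beta y c eps rho1) g) <=
    Cbound s mu beta eps rho1 rho2 d.
Proof.
move=> eps0 Kg.
have [kappa [F [F1 [F2 [k0 HF -> CE]]]]] := Jtrans_profile s eps0.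
have H := differentiable_semidual mu y rho2 n_gt0 beta_gt0 c_ge0 c_cont eps0 HF.
rewrite gradientZ//.
have -> : norm1 (kappa *: gradient
    (fun g => \int[mu]_x F (sumZ beta y c eps x g)) g) =
    kappa * norm1 (gradient (fun g => \int[mu]_x F (sumZ beta y c eps x g)) g).
  rewrite /norm1 mulr_sumr; apply: eq_bigr => k _.
  by rewrite mxE normrM gtr0_norm.
rewrite -(ler_pM2l eps0) -CE.
have := norm1_gradient_semidual_le mu y n_gt0 beta_gt0 c_ge0 c_cont eps0 HF Kg.
rewrite mulrCA ler_pM2l// => /(ler_wpM2l (ltW eps0)) /le_trans; apply.
by rewrite le_eqVlt; apply/orP; left; apply/eqP; field; rewrite gt_eqF.
Qed.

Lemma smooth_below_Jtrans s eps : 0 < eps ->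
  smooth_below rho2 (fun d => 2 * Cbound s mu beta eps rho1 rho2 d / eps)
    (Jtrans s mu beta y c eps rho1).
Proof.
move=> eps0; have [kappa [F [F1 [F2 [k0 HF -> CE]]]]] := Jtrans_profile s eps0.
apply: (@smooth_below_ext _ _ _ (fun d => kappa *
  (2 * marginal_bound beta eps rho2 F1 d / eps ^+ 2 * fine (mu setT)))).
  move=> d.
  have -> : kappa * (2 * marginal_bound beta eps rho2 F1 d / eps ^+ 2 *
                     fine (mu setT)) =
      2 / eps ^+ 2 *
      (kappa * (marginal_bound beta eps rho2 F1 d * fine (mu setT))) by ring.
  by rewrite CE; field; rewrite gt_eqF.
apply: smooth_belowZ; first exact: ltW.
split=> [g|g|d u v].
- exact: (differentiable_semidual mu y rho2 n_gt0 beta_gt0 c_ge0 c_cont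
    eps0 HF).
- exact: (differentiable_gradient_semidual mu y rho2 n_gt0 beta_gt0 c_ge0
    c_cont eps0 HF).
- exact: (lipschitz_gradient_semidual mu y n_gt0 beta_gt0 c_ge0 c_cont
    eps0 HF).
Qed.

Lemma smooth_below_Jobj s eps : 0 < rho2 -> 0 < eps ->
  smooth_below rho2
    (fun d => 2 * Cbound s mu beta eps rho1 rho2 d / eps + mass / rho2)
    (Jobj s mu beta y c eps rho1 rho2).
Proof.
move=> rho20 eps0; apply: smooth_belowD; first exact: smooth_below_Jtrans.
exact: smooth_below_penalty.
Qed.

(** For the KL source, [0 < alpha < 1]. For the chi-square source, write
[m] for the total mass of [nu] and
[z = (rho1 * (1 + m) + rho2 + d) / eps]: then [z >= rho1 / eps * m] and
[exp z >= exp ((rho1 + rho2 + d) / eps)], so [z * exp z] dominates the argument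
of [W]; hence [W <= z], and the prefactor [eps / rho1] cancels the [1 / eps] in
[z]. *)
Lemma Cbound_bounded s d : 0 <= rho2 + d ->
  exists M, forall eps, 0 < eps -> 0 <= Cbound s mu beta eps rho1 rho2 d <= M.
Proof.
move=> rd0; case: s.
- exists (fine (mu setT) * (1 + mass) * expR ((rho2 + d) / rho1)) => eps eps0.
  have mu0 : 0 <= fine (mu setT) by exact: fine_ge0.
  rewrite /Cbound -/mass; apply/andP; split.
    by rewrite !mulr_ge0 ?powR_ge0 ?expR_ge0.
  have m1 : 1 <= 1 + mass by rewrite lerDl.
  apply: ler_pM; rewrite ?mulr_ge0 ?powR_ge0 ?expR_ge0//.
    rewrite ler_wpM2l//.
    have a0 : 0 <= alpha eps rho1 by rewrite divr_ge0 ?addr_ge0// ltW.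
    have a1 : alpha eps rho1 <= 1.
      by rewrite ler_pdivrMr ?addr_gt0// mul1r lerDl ltW.
    apply: (@le_trans _ _ ((1 + mass) `^ alpha eps rho1)).
      apply: ge0_ler_powR => //; rewrite ?nnegrE ?addr_ge0//.
      by rewrite lerDr.
    by rewrite -[leRHS]powRr1 ?addr_ge0//; apply: ler_powR.
  rewrite ler_expR ler_wpM2l// lef_pV2 ?posrE ?addr_gt0//.
  by rewrite lerDl ltW.
- exists (fine (mu setT) * ((rho1 * (1 + mass) + (rho2 + d)) / rho1)).
  move=> eps eps0.
  have mu0 : 0 <= fine (mu setT) by exact: fine_ge0.
  rewrite /Cbound -/mass.
  have re0 : 0 < rho1 / eps by rewrite divr_gt0.
  have u0 :
      0 <= rho1 / eps * expR (rho1 / eps) * mass * expR ((rho2 + d) / eps).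
    by rewrite mulr_ge0 ?expR_ge0// mulr_ge0// mulr_ge0 ?expR_ge0// ltW.
  have er : 0 <= eps / rho1 by rewrite divr_ge0// ltW.
  apply/andP; split.
    by rewrite mulr_ge0 ?lambertW_ge0// mulr_ge0.
  pose z := (rho1 * (1 + mass) + (rho2 + d)) / eps.
  have z0 : 0 <= z.
    rewrite divr_ge0 ?(ltW eps0)// addr_ge0// mulr_ge0 ?addr_ge0//.
    exact: ltW.
  have -> : fine (mu setT) * ((rho1 * (1 + mass) + (rho2 + d)) / rho1) =
    fine (mu setT) * (eps / rho1) * z.
    by rewrite /z; field; rewrite !gt_eqF.
  apply: ler_wpM2l; first exact: mulr_ge0.
  apply: lambertW_le => //.
  have -> : rho1 / eps * expR (rho1 / eps) * mass * expR ((rho2 + d) / eps) =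
    (rho1 / eps * mass) * expR ((rho1 + (rho2 + d)) / eps).
    by rewrite (mulrDl rho1) expRD; ring.
  have rm0 : 0 <= rho1 / eps * mass by rewrite mulr_ge0// ltW.
  apply: ler_pM => //.
    rewrite mulrAC ler_pM2r ?invr_gt0// mulrDr mulr1 addrAC lerDr.
    by rewrite addr_ge0// ltW.
  rewrite ler_expR ler_pM2r ?invr_gt0// lerD2r mulrDr mulr1 lerDl.
  by rewrite mulr_ge0// ltW.
Qed.

End Transport.
Theorem lemma5 (R : realType) (X : ptopologicalType) (Y : topologicalType)
    (polX : polish_space R X) (polY : polish_space R Y)
    (mu : {finite_measure set (borelType X) -> \bar R})
    (n : nat) (n_gt0 : (0 < n)%N) (beta : 'I_n -> R) (y : 'I_n -> Y)
    (b B : R) (b_gt0 : 0 < b) (leBb : b <= B)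
    (beta_gt0 : forall j, 0 < beta j)
    (beta_bnd : forall j, b / n%:R <= beta j <= B / n%:R)
    (c : X -> Y -> R) (c_ge0 : forall x z, 0 <= c x z)
    (c_cont : continuous (fun p : X * Y => c p.1 p.2))
    (rho1 rho2 delta : R) (rho1_gt0 : 0 < rho1) (rho2_gt0 : 0 < rho2)
    (delta_gt0 : 0 < delta) (s : source) :
  (forall eps : R, 0 < eps ->
     forall g : 'rV[R]_n, Kset rho2 delta g ->
       differentiable (Jtrans s mu beta y c eps rho1) g /\
       norm1 (gradient (Jtrans s mu beta y c eps rho1) g)
         <= Cbound s mu beta eps rho1 rho2 delta) /\
  (forall eps : R, 0 < eps ->
     (forall g : 'rV[R]_n, Kset rho2 delta g ->
        twice_differentiable (Jobj s mu beta y c eps rho1 rho2) g) /\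
     [bounded hessian (Jobj s mu beta y c eps rho1 rho2) g
       | g in Kset rho2 delta]) /\
  (exists L : R -> R,
     (forall eps : R, 0 < eps ->
        smooth_on (L eps) (Jobj s mu beta y c eps rho1 rho2)
          (Kset rho2 delta)) /\
     L =O_ (0^'+) (fun eps : R => eps^-1)).
Proof.
have rd0 : 0 <= rho2 + delta by rewrite addr_ge0// ltW.
have m0 : 0 <= (\sum_(j < n) beta j) / rho2.
  by rewrite divr_ge0 ?(ltW rho2_gt0)// sumr_ge0// => j _; exact: ltW.
have [M CM] := Cbound_bounded mu beta_gt0 rho1_gt0 s rd0.
have smoothJ (eps : R) (eps0 : 0 < eps) :=
  smooth_below_Jobj mu y n_gt0 beta_gt0 c_ge0 c_cont rho1_gt0 s rho2_gt0 eps0.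
split; [|split].
- move=> eps eps0 g Kg; split; first exact: (differentiable_Jtrans mu y rho2).
  exact: norm1_gradient_Jtrans_le.
- move=> eps eps0; split; last exact: (smooth_below_hessian _ (smoothJ _ eps0)).
  by move=> g _; exact: (smooth_below_twice_differentiable _ (smoothJ _ eps0)).
exists (fun eps => n%:R * (2 * Cbound s mu beta eps rho1 rho2 delta / eps +
                           (\sum_(j < n) beta j) / rho2)); split.
- move=> eps eps0; apply: (smooth_below_smooth_on (smoothJ _ eps0)).
  case/andP: (CM _ eps0) => C0 _.
  by rewrite addr_ge0// divr_ge0 ?(ltW eps0)// mulr_ge0.
apply/eqO_exP; exists (`|n%:R * (2 * M + (\sum_(j < n) beta j) / rho2)| + 1).
  by rewrite ltr_wpDl.
near=> eps.
have eps0 : 0 < eps by near: eps; exact: nbhs_right_gt.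
have eps1 : eps < 1 by near: eps; exact: nbhs_right_lt.
case/andP: (CM _ eps0) => C0 CMe.
have e1 : 0 <= eps^-1 by rewrite invr_ge0 ltW.
have L0 : 0 <= n%:R * (2 * Cbound s mu beta eps rho1 rho2 delta / eps +
  (\sum_(j < n) beta j) / rho2).
  by rewrite mulr_ge0// addr_ge0// divr_ge0 ?(ltW eps0)// mulr_ge0.
rewrite (ger0_norm L0) (ger0_norm e1).
apply: (@le_trans _ _ (n%:R * (2 * M + (\sum_(j < n) beta j) / rho2) * eps^-1)).
  rewrite -[leRHS]mulrA; apply: ler_wpM2l => //.
  rewrite (mulrDl (2 * M)); apply: lerD.
    by rewrite ler_wpM2r// ler_wpM2l.
  by rewrite ler_peMr// invf_ge1// ltW.
rewrite ler_wpM2r//; apply: le_trans (ler_norm _) _.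
by rewrite lerDl.
Unshelve. all: by end_near. Qed.
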